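(* For all $n\geq1$, $$\sum_{i=1}^{2n}B_{2i-1}=\left(\frac{20B_{n+1}^{neobc}-7C_{n+1}^{neobc}-15}{6}\right)^{2},\qquad 1+\sum_{i=1}^{4n+2}c_{i}=\left(\frac{4R_{n+1}^{neobc}+5}{3}\right)^{2},$$ $$1+\sum_{i=1}^{8n-5}P_{i}=\left(\frac{-4B_{n}^{neobc}+2C_{n}^{neobc}+3}{3}\right)^{2},\qquad \sum_{i=1}^{4n}Q_{2i-1}=\left(\frac{40B_{n+1}^{neobc}-14C_{n+1}^{neobc}-30}{3}\right)^{2},$$ $$\frac{1}{2}\sum_{i=0}^{4n}Q_{2i+1}=\left(\frac{12B_{n+1}^{neobc}-4C_{n+1}^{neobc}-9}{3}\right)^{2}.$$
   Context: Let $\alpha=1+\sqrt2$, $\beta=1-\sqrt2$. Balancing numbers $B_k=\frac{\alpha^{2k}-\beta^{2k}}{4\sqrt2}$; Lucas-cobalancing numbers $c_k=\frac{\alpha^{2k-1}+\beta^{2k-1}}{2}$ ($k\ge1$; so $c_1=1,c_2=7$); Pell numbers $P_0=0,P_1=1,P_k=2P_{k-1}+P_{k-2}$; Pell-Lucas numbers $Q_0=Q_1=2,Q_k=2Q_{k-1}+Q_{k-2}$. A positive integer $m$ is a neo balcobalancing number if there is a positive integer $r$ (its neo balcobalancer) such that $(1+2+\cdots+(m-1))+(1+2+\cdots+m)=2[(m-1)+m+(m+1)+(m+2)+\cdots+(m+r)]$; then $r=\frac{-2m-1+\sqrt{8m^2-12m+9}}{2}$ (equivalently, $m$ is a neo balcobalancing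 number iff $8m^2-12m+9$ is a perfect square). $B_n^{neobc}$ denotes the $n$-th neo balcobalancing number in increasing order ($n\ge1$), $R_n^{neobc}$ its neo balcobalancer and $C_n^{neobc}=\sqrt{8(B_n^{neobc})^2-12B_n^{neobc}+9}$. *)

(* Defs.v *)
From HB Require Import structures.
From mathcomp Require Import all_boot all_order all_algebra.
From mathcomp Require Import zify.
Set Implicit Arguments.
Unset Strict Implicit.
Unset Printing Implicit Defensive.
Import Order.TTheory GRing.Theory Num.Theory.

Section RealSequences.
Local Open Scope ring_scope.

Definition alpha (R : rcfType) : R := 1 + Num.sqrt 2%:R.
Definition beta (R : rcfType) : R := 1 - Num.sqrt 2%:R.

Definition balancing (R : rcfType) (k : nat) : R :=
  (alpha R ^+ (2 * k) - beta R ^+ (2 * k)) / (4%:R * Num.sqrt 2%:R).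

(* Only meant for k >= 1: the exponent is a truncated subtraction. *)
Definition lucas_cobalancing (R : rcfType) (k : nat) : R :=
  (alpha R ^+ (2 * k - 1) + beta R ^+ (2 * k - 1)) / 2%:R.

End RealSequences.

Fixpoint pell (k : nat) : nat :=
  match k with
  | 0 => 0
  | 1 => 1
  | (k''.+1 as k').+1 => 2 * pell k' + pell k''
  end.

Fixpoint pell_lucas (k : nat) : nat :=
  match k with
  | 0 => 2
  | 1 => 2
  | (k''.+1 as k').+1 => 2 * pell_lucas k' + pell_lucas k''
  end.

Definition is_neo_balcobalancer (m r : nat) : bool :=
  [&& 0 < m, 0 < r &
    \sum_(1 <= i < m) i + \sum_(1 <= i < m.+1) i
      == 2 * \sum_(m - 1 <= i < (m + r).+1) i].

Definition neo_balcobalancing (m : nat) : Prop :=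
  exists r : nat, is_neo_balcobalancer m r.

Lemma is_neo_balcobalancerE m r :
  is_neo_balcobalancer m r =
    [&& 0 < m, 0 < r & m ^ 2 == (r + 2) * (2 * m + r - 1)].
Proof.
rewrite /is_neo_balcobalancer; case: m => [//|m] /=.
suff -> : \sum_(1 <= i < m.+1) i + \sum_(1 <= i < m.+2) i = m.+1 ^ 2.
  suff -> : 2 * \sum_(m.+1 - 1 <= i < (m.+1 + r).+1) i
            = (r + 2) * (2 * m.+1 + r - 1) by [].
  rewrite subn1 /=; elim: r => [|r IHr].
    by rewrite addn0 big_nat_recr //= big_nat1; lia.
  by rewrite big_nat_recr /=; [rewrite addnS mulnDr IHr; nia | lia].
elim: m => [|m IHm]; first by rewrite big_geq // big_nat1.
rewrite big_nat_recr //= [X in _ + X]big_nat_recr //=; nia.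
Qed.

(* The bound on r loses nothing: the balcobalancer of m is smaller than m ^ 2. *)
Definition neo_balcobalancingb (m : nat) : bool :=
  [exists r : 'I_(m ^ 2), is_neo_balcobalancer m r].

Lemma is_neo_balcobalancer_lt m r : is_neo_balcobalancer m r -> r < m ^ 2.
Proof. by rewrite is_neo_balcobalancerE => /and3P[m0 r0 /eqP ->]; nia. Qed.

Lemma neo_balcobalancingP m :
  reflect (neo_balcobalancing m) (neo_balcobalancingb m).
Proof.
apply: (iffP existsP) => [[r Hr]|[r Hr]]; first by exists r.
by exists (Ordinal (is_neo_balcobalancer_lt Hr)).
Qed.

Lemma neo_balcobalancing_unbounded k :
  exists m : nat, (k < m) && neo_balcobalancingb m.
Proof.
suff [m km [r Hr]] : exists2 m, k < m & neo_balcobalancing m.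
  by exists m; rewrite km; apply/neo_balcobalancingP; exists r.
elim: k => [|k [m km [r Hr]]].
  by exists 6 => //; exists 1; rewrite is_neo_balcobalancerE.
exists (29 * m + 12 * r - 6); first by lia.
exists (12 * m + 5 * r - 4); move: Hr.
rewrite !is_neo_balcobalancerE => /and3P[m0 r0 /eqP Hr].
apply/and3P; split; [lia | lia | apply/eqP].
case: m m0 Hr {km} => [//|a] _; case: r r0 => [//|b] _.
have -> : 2 * a.+1 + b.+1 - 1 = 2 * a + b + 2 by lia.
have -> : 29 * a.+1 + 12 * b.+1 - 6 = 29 * a + 12 * b + 35 by lia.
have -> : 12 * a.+1 + 5 * b.+1 - 4 = 12 * a + 5 * b + 13 by lia.
have -> : 2 * (29 * a + 12 * b + 35) + (12 * a + 5 * b + 13) - 1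
          = 70 * a + 29 * b + 82 by lia.
by rewrite -!mulnn; lia.
Qed.

(* The n-th neo balcobalancing number in increasing order, n >= 1: the least  *)
(* one exceeding the previous one.  The value at 0 only starts the recursion. *)
Fixpoint Bneobc (n : nat) : nat :=
  if n is n'.+1 then ex_minn (neo_balcobalancing_unbounded (Bneobc n')) else 0.

(* The balcobalancer of m; junk value 0 if m is not neo balcobalancing. *)
Definition neo_balcobalancer (m : nat) : nat :=
  if [pick r : 'I_(m ^ 2) | is_neo_balcobalancer m r] is Some r
  then val r else 0.

Definition Rneobc (n : nat) : nat := neo_balcobalancer (Bneobc n).

Definition Cneobc (R : rcfType) (n : nat) : R :=
  (Num.sqrt (8%:R * (Bneobc n)%:R ^+ 2 - 12%:R * (Bneobc n)%:R + 9%:R))%R.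

(* Main.v *)
Require Import Defs.
From mathcomp Require Import all_boot all_order all_algebra.
From mathcomp Require Import zify ring lra.
Set Implicit Arguments.
Unset Strict Implicit.
Unset Printing Implicit Defensive.
Import Order.TTheory GRing.Theory Num.Theory.
Local Open Scope ring_scope.

(** The balcobalancer equation is the Pell equation
    [(4 m - 3) ^ 2 - 2 (2 m + 2 r + 1) ^ 2 = -9], whose solutions are permuted
    by [(m, r) |-> (29 m + 12 r - 6, 12 m + 5 r - 4)].  This map is increasing
    and every solution other than [(6, 1)] has a smaller preimage, so it
    enumerates the neo balcobalancing numbers.  Hence the n-th one and its
    balcobalancer are affine functions of [P_(4 n - 4)] and [P_(4 n - 3)], and
    each of the five identities follows from the duplication formulas and the
    Cassini identity for Pell numbers. *)

(** * Solutions of the balcobalancer equation and their enumeration *)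

Section NeoBalcobalancing.
Local Open Scope nat_scope.

Lemma is_neo_balcobalancer_step m r :
  is_neo_balcobalancer m r ->
  is_neo_balcobalancer (29 * m + 12 * r - 6) (12 * m + 5 * r - 4).
Proof.
rewrite !is_neo_balcobalancerE => /and3P[m0 r0 /eqP Hr].
apply/and3P; split; [lia | lia | apply/eqP].
case: m m0 Hr => [//|a] _; case: r r0 => [//|b] _.
have -> : 2 * a.+1 + b.+1 - 1 = 2 * a + b + 2 by lia.
have -> : 29 * a.+1 + 12 * b.+1 - 6 = 29 * a + 12 * b + 35 by lia.
have -> : 12 * a.+1 + 5 * b.+1 - 4 = 12 * a + 5 * b + 13 by lia.
have -> : 2 * (29 * a + 12 * b + 35) + (12 * a + 5 * b + 13) - 1
          = 70 * a + 29 * b + 82 by lia.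
by rewrite -!mulnn; lia.
Qed.

(** As a quadratic in [r], the equation has discriminant [8 m ^ 2 - 12 m + 9], with square root
    [2 m + 2 r + 1]. Hence [m] determines [r]. *)
Lemma is_neo_balcobalancer_sqr m r :
  is_neo_balcobalancer m r ->
  (2 * m + 2 * r + 1) ^ 2 + 12 * m = 8 * m ^ 2 + 9.
Proof.
rewrite is_neo_balcobalancerE => /and3P[m0 r0 /eqP].
case: m m0 => [//|a] _.
have -> : 2 * a.+1 + r - 1 = 2 * a + r + 1 by lia.
by rewrite -!mulnn; lia.
Qed.

Lemma neo_balcobalancer_eq m r :
  is_neo_balcobalancer m r -> neo_balcobalancer m = r.
Proof.
move=> mr; rewrite /neo_balcobalancer.
case: pickP => [s /= ms|/(_ (Ordinal (is_neo_balcobalancer_lt mr)))]; last first.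
  by rewrite /= mr.
have := is_neo_balcobalancer_sqr mr; have := is_neo_balcobalancer_sqr ms.
rewrite -!mulnn; nia.
Qed.

Lemma is_neo_balcobalancer_mono m r m' r' :
  is_neo_balcobalancer m r -> is_neo_balcobalancer m' r' -> m <= m' ->
  29 * m + 12 * r - 6 <= 29 * m' + 12 * r' - 6.
Proof.
move=> mr mr' le_mm'.
(* With [c = 2 m + 2 r + 1] the image is [17 m + 6 c - 12], and [c ^ 2 = 8 m ^ 2 - 12 m + 9] grows
   with [m >= 1]. *)
suff: 2 * m + 2 * r + 1 <= 2 * m' + 2 * r' + 1 by lia.
have m0 : 0 < m by case/and3P: mr.
have := is_neo_balcobalancer_sqr mr; have := is_neo_balcobalancer_sqr mr'.
move: (2 * m + 2 * r + 1) (2 * m' + 2 * r' + 1) => c c'.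
rewrite -!mulnn; nia.
Qed.

Lemma is_neo_balcobalancer_ge6 m r : is_neo_balcobalancer m r -> 6 <= m.
Proof.
rewrite is_neo_balcobalancerE => /and3P[m0 r0 /eqP Hr].
rewrite leqNgt; apply/negP => m5.
have r5 : r < 5 by nia.
by case: m m0 Hr m5 => [|[|[|[|[|[|m]]]]]] // _ Hr _;
   case: r r0 Hr r5 => [|[|[|[|[|r]]]]].
Qed.

Lemma is_neo_balcobalancer_pred m r :
  is_neo_balcobalancer m r -> 6 < m ->
  exists m' r', [/\ is_neo_balcobalancer m' r', m = 29 * m' + 12 * r' - 6
                  & r = 12 * m' + 5 * r' - 4].
Proof.
rewrite is_neo_balcobalancerE => /and3P[m0 r0 /eqP Hr] m7.
have Hr' : m ^ 2 + r + 2 = (r + 2) * (2 * m + r) by nia.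
move: Hr' {Hr}; rewrite -mulnn => Hr.
(* Positivity of the first component of the preimage, by squaring. At [(6, 1)] there is equality,
   which is why [6 < m] is assumed. *)
have lt_m : 12 * r + 18 < 5 * m.
  rewrite ltnNge; apply/negP => le_m.
  have : (17 * m) * (17 * m) <= (12 * m + 12 * r + 18) * (12 * m + 12 * r + 18).
    by apply: leq_mul; lia.
  by nia.
(* For the candidate preimage [(m', r')] over the integers this says [2 m' + 2 r' + 1 > 0]; it
   yields [z <= t] below. *)
have lt_C : 14 * m < 34 * r + 53.
  rewrite ltnNge; apply/negP => le_C.
  have : (34 * m + 34 * r + 53) * (34 * m + 34 * r + 53) <= (48 * m) * (48 * m).
    by apply: leq_mul; lia.
  by nia.
(* The size bounds alone allow a preimage with second component [- z <= 0]; the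
   equation for integers excludes it, [(t - 2) ^ 2 = 2] being unsolvable. *)
have lt_r : 12 * m < 29 * r + 44.
  rewrite ltnNge; apply/negP => le_r.
  have [t Ht] : exists t, 5 * m = 12 * r + 18 + t.
    by exists (5 * m - 12 * r - 18); lia.
  have [z Hz] : exists z, 12 * m = 29 * r + 44 + z.
    by exists (12 * m - 29 * r - 44); lia.
  have Em : (m%:Z = 29 * t%:Z - 12 * z%:Z - 6)%R by lia.
  have Er : (r%:Z = 12 * t%:Z - 5 * z%:Z - 4)%R by lia.
  have Htz : (t%:Z * t%:Z = (2 - z%:Z) * (2 * t%:Z - z%:Z - 1))%R.
    have : (m%:Z * m%:Z + r%:Z + 2 = (r%:Z + 2) * (2 * m%:Z + r%:Z))%R by lia.
    by rewrite Em Er; lia.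
  have le_zt : z <= t by lia.
  have [s Hs] : exists s, t = z + s by exists (t - z); lia.
  move: Htz; rewrite Hs {Ht Hz Em Er le_zt Hs}.
  case: z => [|[|z]] Htz; [|nia|nia].
  by case: s Htz => [|[|[|[|s]]]]; nia.
(* The linear part of the map has determinant [29 * 5 - 12 * 12 = 1], so its inverse is integral. *)
exists (5 * m - 12 * r - 18), (29 * r + 44 - 12 * m).
split; [|lia|lia].
rewrite is_neo_balcobalancerE; apply/and3P; split; [lia|lia|apply/eqP].
have [x Hx] : exists x, 5 * m = 12 * r + 18 + x.+1.
  by exists (5 * m - 12 * r - 19); lia.
have [y Hy] : exists y, 29 * r + 44 = 12 * m + y.
  by exists (29 * r + 44 - 12 * m); lia.
have -> : 5 * m - 12 * r - 18 = x.+1 by lia.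
have -> : 29 * r + 44 - 12 * m = y by lia.
have -> : 2 * x.+1 + y - 1 = 2 * x + y + 1 by lia.
have Em : m = 29 * x + 12 * y + 23 by lia.
have Er : r = 12 * x + 5 * y + 8 by lia.
by move: Hr; rewrite Em Er -!mulnn; lia.
Qed.

Lemma BneobcS_min n m :
  neo_balcobalancing m -> Bneobc n < m -> Bneobc n.+1 <= m.
Proof.
move=> /neo_balcobalancingP Hm lt_m /=; case: ex_minnP => k _; apply.
by rewrite lt_m.
Qed.

Lemma Bneobc_lt n : Bneobc n < Bneobc n.+1.
Proof. by rewrite [Bneobc n.+1]/=; case: ex_minnP => k /andP[]. Qed.

Lemma BneobcP n : is_neo_balcobalancer (Bneobc n.+1) (Rneobc n.+1).
Proof.
rewrite /Rneobc; have [r Hr] : neo_balcobalancing (Bneobc n.+1).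
  by rewrite /=; case: ex_minnP => k /andP[_ /neo_balcobalancingP].
by rewrite (neo_balcobalancer_eq Hr).
Qed.

Lemma Bneobc1 : Bneobc 1 = 6.
Proof.
apply/eqP; rewrite eqn_leq (is_neo_balcobalancer_ge6 (BneobcP 0)) andbT.
by apply: BneobcS_min => //; exists 1; rewrite is_neo_balcobalancerE.
Qed.

Lemma Rneobc1 : Rneobc 1 = 1.
Proof.
by rewrite /Rneobc Bneobc1; apply: neo_balcobalancer_eq;
   rewrite is_neo_balcobalancerE.
Qed.

(** Minimality bounds the next number by the image of the current one. Conversely, the next number
    has a preimage; by monotonicity and induction it exceeds the previous number, so it is at least
    the current one. *)
Lemma BneobcSS n : Bneobc n.+2 = 29 * Bneobc n.+1 + 12 * Rneobc n.+1 - 6.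
Proof.
have B_ge6 k := is_neo_balcobalancer_ge6 (BneobcP k).
have le_B k : Bneobc k.+2 <= 29 * Bneobc k.+1 + 12 * Rneobc k.+1 - 6.
  apply: BneobcS_min; last by have := B_ge6 k; lia.
  by eexists; apply: is_neo_balcobalancer_step (BneobcP k).
elim: n => [|n IHn]; apply/eqP; rewrite eqn_leq le_B andTb.
- have lt_B : 6 < Bneobc 2 by rewrite -Bneobc1 Bneobc_lt.
  have [m [r [mr -> _]]] := is_neo_balcobalancer_pred (BneobcP 1) lt_B.
  apply: (is_neo_balcobalancer_mono (BneobcP 0) mr).
  by rewrite Bneobc1; apply: is_neo_balcobalancer_ge6 mr.
have lt_B : 6 < Bneobc n.+3 by apply: leq_ltn_trans (Bneobc_lt _); apply: B_ge6.
have [m [r [mr Em _]]] := is_neo_balcobalancer_pred (BneobcP n.+2) lt_B.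
rewrite Em; apply: (is_neo_balcobalancer_mono (BneobcP _) mr).
apply: BneobcS_min; first by exists r.
rewrite ltnNge; apply/negP => /(is_neo_balcobalancer_mono mr (BneobcP _)).
by rewrite -Em -IHn leqNgt Bneobc_lt.
Qed.

Lemma RneobcSS n : Rneobc n.+2 = 12 * Bneobc n.+1 + 5 * Rneobc n.+1 - 4.
Proof.
rewrite {1}/Rneobc BneobcSS; apply: neo_balcobalancer_eq.
exact: is_neo_balcobalancer_step (BneobcP n).
Qed.

Lemma pellSS k : pell k.+2 = 2 * pell k.+1 + pell k.
Proof. by []. Qed.

(** The index [4 * n] appears because the matrix with rows [(29, 12)] and [(12, 5)] is the fourth
    power of the Pell matrix with rows [(2, 1)] and [(1, 0)]. *)
Lemma Bneobc_Rneobc_pell n :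
  4 * Bneobc n.+1 = 9 * pell (4 * n) + 21 * pell (4 * n).+1 + 3 /\
  4 * Rneobc n.+1 + 5 = 3 * pell (4 * n) + 9 * pell (4 * n).+1.
Proof.
elim: n => [|n [IHB IHR]]; first by rewrite Bneobc1 Rneobc1.
(* This bound makes the truncated subtractions in the recurrences exact. *)
have B_ge6 := is_neo_balcobalancer_ge6 (BneobcP n).
rewrite BneobcSS RneobcSS mulnS !addSn add0n !pellSS; lia.
Qed.

Lemma pell_lucas_pell k : pell_lucas k + 2 * pell k = 2 * pell k.+1.
Proof.
suff [] : pell_lucas k + 2 * pell k = 2 * pell k.+1 /\
          pell_lucas k.+1 + 2 * pell k.+1 = 2 * pell k.+2 by [].
elim: k => [//|k [IH1 IH2]]; split=> //.
rewrite -[pell_lucas k.+2]/(2 * pell_lucas k.+1 + pell_lucas k) !pellSS.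
by move: IH2; rewrite !pellSS; lia.
Qed.

End NeoBalcobalancing.

(** * Pell identities and sums, in a ring so that subtraction is available *)

Section PellSums.
Variable R : comNzRingType.
Implicit Types k n : nat.

Local Notation p k := ((pell k)%:R : R).

Lemma natr_pellSS k : (pell k.+2)%:R = 2 * p k.+1 + p k.
Proof. by rewrite pellSS natrD natrM. Qed.

Lemma natr_pell_lucas k : (pell_lucas k)%:R = 2 * (p k.+1 - p k).
Proof.
have /(congr1 (fun n => n%:R : R)) := pell_lucas_pell k.
by rewrite natrD !natrM => H; rewrite mulrBr -H addrK.
Qed.

Lemma pell_cassini k :
  p k.+1 ^+ 2 - 2 * p k * p k.+1 - p k ^+ 2 = (-1) ^+ k.
Proof.
elim: k => [|k IHk]; first by rewrite /= expr0; ring.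
by rewrite [RHS]exprS -IHk !natr_pellSS; ring.
Qed.

Lemma pell_double k :
  (pell (2 * k))%:R = 2 * p k * (p k.+1 - p k) /\
  (pell (2 * k).+1)%:R = p k.+1 ^+ 2 + p k ^+ 2.
Proof.
elim: k => [|k [IH1 IH2]]; first by rewrite /=; split; ring.
have -> : (2 * k.+1 = (2 * k).+2)%N by rewrite mulnS.
by rewrite !natr_pellSS IH1 IH2; split; ring.
Qed.

Lemma sum_pell n : 2 * \sum_(1 <= i < n.+1) p i = p n.+1 + p n - 1.
Proof.
elim: n => [|n IHn]; first by rewrite big_geq // /=; ring.
by rewrite big_nat_recr // mulrDr IHn !natr_pellSS; ring.
Qed.

(** The sum telescopes: [2 P_(4 n + 2) = P_(2 n + 2) ^ 2 - P_(2 n) ^ 2] by duplication. *)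
Lemma sum_pell_even n :
  2 * \sum_(1 <= i < n.+1) p (2 * (2 * i - 1)) = p (2 * n) ^+ 2.
Proof.
elim: n => [|n IHn]; first by rewrite big_geq // /=; ring.
rewrite big_nat_recr // mulrDr IHn.
have -> : (2 * n.+1 - 1 = (2 * n).+1)%N by lia.
have -> : (2 * n.+1 = (2 * n).+2)%N by lia.
by rewrite (pell_double (2 * n).+1).1 !natr_pellSS; ring.
Qed.

Lemma sum_pell_lucas_odd n :
  \sum_(1 <= i < n.+1) (pell_lucas (2 * i - 1))%:R
    = p (2 * n).+1 - p (2 * n) - 1.
Proof.
elim: n => [|n IHn]; first by rewrite big_geq // /=; ring.
rewrite big_nat_recr // IHn natr_pell_lucas.
have -> : (2 * n.+1 - 1 = (2 * n).+1)%N by lia.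
have -> : (2 * n.+1 = (2 * n).+2)%N by lia.
by rewrite !natr_pellSS /=; ring.
Qed.

End PellSums.

(** * From powers of [alpha] and [beta] to Pell numbers *)

Section Binet.
Variable R : rcfType.

Let sqrt2_sqr : Num.sqrt 2%:R ^+ 2 = 2 :> R.
Proof. by rewrite sqr_sqrtr ?ler0n. Qed.

Lemma binet k :
  alpha R ^+ k = (pell k.+1)%:R - (pell k)%:R + (pell k)%:R * Num.sqrt 2%:R /\
  beta R ^+ k = (pell k.+1)%:R - (pell k)%:R - (pell k)%:R * Num.sqrt 2%:R.
Proof.
elim: k => [|k [IHa IHb]]; first by rewrite !expr0 /=; split; ring.
rewrite !exprS IHa IHb natr_pellSS /alpha /beta.
by split; ring: sqrt2_sqr.
Qed.

Lemma balancing_pell k : balancing R k = (pell (2 * k))%:R / 2%:R.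
Proof.
have sqrt2_neq0 : Num.sqrt 2%:R != 0 :> R by rewrite sqrtr_eq0 -ltNge ltr0n.
rewrite /balancing (binet _).1 (binet _).2; field.
by rewrite sqrt2_neq0.
Qed.

Lemma lucas_cobalancing_pell_lucas k :
  lucas_cobalancing R k = (pell_lucas (2 * k - 1))%:R / 2%:R.
Proof.
by rewrite /lucas_cobalancing (binet _).1 (binet _).2 natr_pell_lucas; field.
Qed.

Lemma Cneobc_Rneobc n :
  Cneobc R n.+1 = 2%:R * (Bneobc n.+1)%:R + 2%:R * (Rneobc n.+1)%:R + 1.
Proof.
have /(congr1 (fun n => n%:R : R)) := is_neo_balcobalancer_sqr (BneobcP n).
rewrite !(natrD, natrM, natrX) => H.
rewrite /Cneobc; set c := RHS.
have -> : 8%:R * (Bneobc n.+1)%:R ^+ 2 - 12%:R * (Bneobc n.+1)%:R + 9%:R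
  = c ^+ 2 by rewrite /c; lra.
by rewrite sqrtr_sqr ger0_norm // /c !addr_ge0 ?mulr_ge0 ?ler0n.
Qed.

Lemma neobc_pell n (a := (pell (4 * n))%:R : R)
    (b := (pell (4 * n).+1)%:R : R) :
  [/\ (Bneobc n.+1)%:R = (9%:R * a + 21%:R * b + 3%:R) / 4%:R,
      (Rneobc n.+1)%:R = (3%:R * a + 9%:R * b - 5%:R) / 4%:R
    & Cneobc R n.+1 = 6%:R * a + 15%:R * b].
Proof.
have [/(congr1 (fun n => n%:R : R)) HB /(congr1 (fun n => n%:R : R)) HR] :=
  Bneobc_Rneobc_pell n.
move: HB HR; rewrite !(natrM, natrD) -/a -/b => HB HR.
by rewrite Cneobc_Rneobc; split; lra.
Qed.

End Binet.

Theorem theorem9p3 (R : rcfType) (n : nat) (hn : (1 <= n)%N) :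
  [/\ \sum_(1 <= i < (2 * n).+1) balancing R (2 * i - 1)
        = ((20%:R * (Bneobc n.+1)%:R - 7%:R * Cneobc R n.+1 - 15%:R) / 6%:R) ^+ 2,
      1 + \sum_(1 <= i < (4 * n + 2).+1) lucas_cobalancing R i
        = ((4%:R * (Rneobc n.+1)%:R + 5%:R) / 3%:R) ^+ 2,
      1 + \sum_(1 <= i < (8 * n - 5).+1) (pell i)%:R
        = ((- 4%:R * (Bneobc n)%:R + 2%:R * Cneobc R n + 3%:R) / 3%:R) ^+ 2,
      \sum_(1 <= i < (4 * n).+1) (pell_lucas (2 * i - 1))%:R
        = ((40%:R * (Bneobc n.+1)%:R - 14%:R * Cneobc R n.+1 - 30%:R) / 3%:R) ^+ 2
    & 1 / 2%:R * \sum_(0 <= i < (4 * n).+1) (pell_lucas (2 * i + 1))%:R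
        = ((12%:R * (Bneobc n.+1)%:R - 4%:R * Cneobc R n.+1 - 9%:R) / 3%:R) ^+ 2].
Proof.
(* At the even index [4 * k] the Cassini sign is [+1]; this relation absorbs the constants [1] in
   the identities. *)
have cassini k : (pell (4 * k).+1)%:R ^+ 2
    = 1 + 2 * (pell (4 * k))%:R * (pell (4 * k).+1)%:R
        + (pell (4 * k))%:R ^+ 2 :> R.
  have := pell_cassini R (4 * k).
  by rewrite -signr_odd oddM andFb expr0; lra.
(* With [a = P_(4 n)] and [b = P_(4 n + 1)], the bases of the squares in the first, second, fourth
   and fifth identities become [a / 2], [a + 3 b], [2 a] and [a + b]. *)
have [-> -> ->] := neobc_pell R n.
split.
- under eq_bigr do rewrite balancing_pell.
  rewrite -mulr_suml.
  have := sum_pell_even R (2 * n); rewrite [(2 * (2 * n))%N]mulnA => H.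
  by lra.
- under eq_bigr do rewrite lucas_cobalancing_pell_lucas.
  rewrite -mulr_suml sum_pell_lucas_odd.
  rewrite (pell_double _ _).1 (pell_double _ _).2 addn2 !natr_pellSS.
  by have := cassini n; lra.
(* This identity involves the [n]-th number rather than the next one, so [n] is replaced by its
   successor; the base is then again [a + 3 b]. *)
- case: n hn => // n _.
  have [-> _ ->] := neobc_pell R n.
  have -> : (8 * n.+1 - 5 = (2 * (4 * n).+1).+1)%N by lia.
  have := sum_pell R (2 * (4 * n).+1).+1.
  rewrite natr_pellSS (pell_double _ _).1 (pell_double _ _).2 !natr_pellSS => H.
  by have := cassini n; lra.
- rewrite sum_pell_lucas_odd (pell_double _ _).1 (pell_double _ _).2.
  by have := cassini n; lra.
have -> : \sum_(0 <= i < (4 * n).+1) (pell_lucas (2 * i + 1))%:R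
    = \sum_(1 <= i < (4 * n).+2) (pell_lucas (2 * i - 1))%:R :> R.
  rewrite [RHS]big_add1; apply: eq_bigr => i _.
  by congr (pell_lucas _)%:R; lia.
rewrite sum_pell_lucas_odd (pell_double _ _).1 (pell_double _ _).2 natr_pellSS.
by have := cassini n; lra.
Qed.
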